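(* Let $\{m_k\}_{k=1}^N$ and $\{n_k\}_{k=1}^N$ be strictly increasing sequences of positive integers, where either $N\in\mathbb{N}$ or $N=\infty$. If $N\in\mathbb{N}$, define $n_{N+1}=\infty$. Define $$\Lambda_1=\bigcup_{k=1}^N\left(2^{-m_k}\mathbb{N}\cap[n_k,n_{k+1})\right).$$ Let $\Lambda_2=\{\alpha_k: k\in\mathbb{N}\}$ be an algebraically independent set (in the sense defined in the context) of irrational numbers, where $\alpha_k\nearrow\infty$. Then $\Lambda_*=\Lambda_1\cup\Lambda_2$ is type 2.
   Context: Here $\mathbb{N}=\{1,2,\dots\}$ and $2^{-m}\mathbb{N}=\{2^{-m}j: j\in\mathbb{N}\}$; $\alpha_k\nearrow\infty$ means that $(\alpha_k)$ is increasing and tends to infinity. Convention: a set of (distinct) real numbers $\{\alpha_1,\alpha_2,\dots\}$ is said to be algebraically independent if for each $N\in\mathbb{N}$, whenever $k_1,\dots,k_N\in\mathbb{Z}$ and $k_1\alpha_1+\dots+k_N\alpha_N=0$, then $k_1=\dots=k_N=0$ (that is, the numbers are linearly independent over $\mathbb{Q}$). A set $\Lambda\subset\mathbb{R}$ is called admissible if it is countably infinite, unbounded, bounded from below, and has no finite accumulation points. Let $\mu$ denote Lebesgue measure on $\mathbb{R}$. For an admissible $\Lambda$ and a (Lebesgue) measurable $f:\mathbb{R}\to[0,+\infty)$, put $s(x)=\sum_{\lambda\in\Lambda}f(x+\lambda)$, $C(f,\Lambda)=\{x\in\mathbb{R}: s(x)<\infty\}$ and $D(f,\Lambda)=\{x\in\mathbb{R}: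 s(x)=\infty\}$. The set $\Lambda$ is type 1 if for every measurable $f:\mathbb{R}\to[0,+\infty)$ either $\mu(D(f,\Lambda))=0$ or $\mu(C(f,\Lambda))=0$. Otherwise $\Lambda$ is type 2. *)

(* Defs.v *)
From HB Require Import structures.
From mathcomp Require Import all_boot all_order all_algebra.
From mathcomp Require Import all_classical all_reals all_analysis.
Set Implicit Arguments.
Unset Strict Implicit.
Unset Printing Implicit Defensive.
Import Order.TTheory GRing.Theory Num.Theory.
Import numFieldNormedType.Exports.
Local Open Scope classical_set_scope.
Local Open Scope ring_scope.

(* R with the Lebesgue (rather than Borel) sigma-algebra: this is the domain of
   completed_lebesgue_measure, whose measurable sets are the sets A `|` N with A
   Borel and N Lebesgue-negligible (completed_caratheodory_measurable). *)
Notation lebesgueType R := (caratheodory_type ((wlength (@idfun R))^*)%mu).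

Section type1_type2.
Variable R : realType.
Implicit Types (f : R -> R) (Lambda : set R).

Definition lebesgue_measurable_fun f :=
  measurable_fun [set: lebesgueType R] (f : lebesgueType R -> R).

Definition admissible Lambda :=
  [/\ countable Lambda, infinite_set Lambda, ~ bounded_set Lambda,
      has_lbound Lambda & limit_point Lambda = set0].

Definition translate_sum f Lambda (x : R) : \bar R :=
  \esum_(l in Lambda) (f (x + l))%:E.

Definition C_set f Lambda : set R :=
  [set x | (translate_sum f Lambda x < +oo)%E].

Definition D_set f Lambda : set R :=
  [set x | translate_sum f Lambda x = +oo%E].

Definition zero_one_law Lambda :=
  forall f, lebesgue_measurable_fun f -> (forall x, 0 <= f x) ->
    completed_lebesgue_measure (D_set f Lambda) = 0%E \/
    completed_lebesgue_measure (C_set f Lambda) = 0%E.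

Definition type1 Lambda := admissible Lambda /\ zero_one_law Lambda.

Definition type2 Lambda := admissible Lambda /\ ~ type1 Lambda.

End type1_type2.

(* All sequences are indexed from 0: the k-th term here is the (k+1)-st term of
   a sequence indexed by {1, 2, ...}.  A length is Some N (finite) or None
   (infinite), and below_length N holds at the indices of a sequence of
   length N; values at other indices are irrelevant. *)
Definition below_length (N : option nat) : pred nat :=
  fun k => if N is Some N' then (k < N')%N else true.

Section the_sets.
Variable R : realType.

Definition dyadic_progression (m : nat) : set R :=
  [set 2 ^- m * j%:R | j in [set j : nat | (0 < j)%N]].

(* The interval [n_k, n_{k+1}[, where n_{k+1} is +oo if k is the last index. *)
Definition block (N : option nat) (n : nat -> nat) (k : nat) : set R :=
  if below_length N k.+1 then `[(n k)%:R, (n k.+1)%:R[%classic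
  else `[(n k)%:R, +oo[%classic.

Definition Lambda1 (N : option nat) (m n : nat -> nat) : set R :=
  \bigcup_(k in [set k | below_length N k])
    (dyadic_progression (m k) `&` block N n k).

(* Despite the name, this is linear independence over the integers, not the
   absence of polynomial relations. *)
Definition algebraically_independent (alpha : nat -> R) :=
  forall (N : nat) (c : 'I_N -> int),
    \sum_(i < N) (c i)%:~R * alpha i = 0 -> forall i, c i = 0.

End the_sets.

(* Main.v *)
Require Import Defs.
From mathcomp Require Import all_boot all_order all_algebra.
From mathcomp Require Import all_classical all_reals all_analysis.
From mathcomp Require Import finmap measurable_realfun.
From mathcomp Require Import ring lra zify.
Import Order.TTheory GRing.Theory Num.Theory.
Import numFieldNormedType.Exports.
Local Open Scope classical_set_scope.
Local Open Scope ring_scope.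

(** The set Lambda1 `|` range alpha fails the zero-one law because Lambda1 and
    the sequence alpha can be separated arithmetically.  Below any bound,
    Lambda1 lies in 2 ^- m * Z for some m, so for an integer Q divisible by
    2 ^ m the translation by an element of Lambda1 does not change the
    fractional part of Q * x.  The fractional parts of Q * alpha k, on the
    other hand, can be prescribed at will for finitely many k by Kronecker's
    theorem, since alpha is linearly independent over the rationals, and even
    independent together with 1 after finitely many terms are dropped
    ([independent_tail]).

    Let rho t = `|sin (pi * t)| measure the distance from t to the integers.
    Given r > 0, choose M such that the points i / M are r-dense modulo 1, pick
    indices sigma 0 < ... < sigma (M - 1) along which alpha has gaps at least 1,
    and choose Q such that Q * alpha (sigma i) is close to i / M modulo 1 while
    Q * alpha k is close to an integer for every other k in sight.  Let U be the
    set of points y with rho (Q * y) < 2 * r that lie in one of the intervals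
    [alpha (sigma i), alpha (sigma i) + 1/4].  Every x in [0, 1/4] is sent into
    U by one of the translations by alpha (sigma i).  A point x of [1/2, 3/4] is
    sent into U by none of these, because of the gaps, and if it is sent there
    by any other element of the set, then rho (Q * x) < 3 * r, which happens
    only on a set of small measure ([divergence_block]).  If f is the indicator
    function of the union of countably many such sets U, with summable
    exceptional measures and with blocks that move off to infinity, the series
    diverges on [0, 1/4] and vanishes on a subset of [1/2, 3/4] of positive
    measure ([zero_one_law_fails]).

    Kronecker's theorem is proved with Fejer kernels.  The product over k of
    fejer p (q * a k - theta k) is a nonnegative trigonometric polynomial in q
    of mean value 1, by independence.  If for every q some q * a k stayed away
    from theta k modulo 1, then one factor of the product would always be
    O(1 / p), and comparing with the products that omit one factor, which also
    have mean 1, would bound the mean by O(n / p) ([kronecker_cos]). *)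

(** * Trigonometric functions of a turn *)

Section TurnFunctions.
Context {R : realType}.
Implicit Types (s t : R) (p n : nat).

Definition turn_cos t : R := cos (2 * pi * t).

(** As a subadditive, even, 1-periodic function vanishing exactly on the
    integers, it serves as the distance of t to the integers. *)
Definition turn_sin t : R := `|sin (pi * t)|.

Lemma turn_sinDn t n : turn_sin (t + n%:R) = turn_sin t.
Proof.
rewrite /turn_sin mulrDr mulr_natr (alternatingn (@sinDpi R)) normrM normrX.
by rewrite normrN1 expr1n mul1r.
Qed.

Lemma turn_sinDz t (z : int) : turn_sin (t + z%:~R) = turn_sin t.
Proof.
case: z => n; first exact: turn_sinDn.
by rewrite NegzE mulrNz -(turn_sinDn _ n.+1) subrK.
Qed.

Lemma turn_sinN t : turn_sin (- t) = turn_sin t.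
Proof. by rewrite /turn_sin mulrN sinN normrN. Qed.

Lemma turn_sinD s t : turn_sin (s + t) <= turn_sin s + turn_sin t.
Proof.
rewrite /turn_sin mulrDr sinD; apply: (le_trans (ler_normD _ _)).
by rewrite !normrM lerD// ?ler_piMr ?ler_piMl ?cos_max.
Qed.

Lemma turn_cosE t : turn_cos t = 1 - 2 * turn_sin t ^+ 2.
Proof.
rewrite /turn_cos /turn_sin real_normK ?num_real// sin2cos2.
have -> : 2 * pi * t = (pi * t) *+ 2 :> R by rewrite mulr2n; ring.
by rewrite cos_mulr2n mulr2n; ring.
Qed.

Lemma turn_sin_gt0 t : ~ (exists z : int, t = z%:~R) -> 0 < turn_sin t.
Proof.
move=> tZ; rewrite -(subrK (Num.floor t)%:~R t) turn_sinDz /turn_sin.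
set u := t - _.
have u0 : 0 <= u by rewrite subr_ge0 floor_le.
have u1 : u < 1 by rewrite ltrBlDl -[1]/(1%:~R) -intrD floorD1_gt.
have un0 : u != 0.
  by apply/eqP => /eqP; rewrite subr_eq0 => /eqP tE; apply: tZ; exists (Num.floor t).
rewrite normr_gt0 gt_eqF// sin_gt0_pi// mulr_gt0 ?pi_gt0 ?lt0r ?un0//=.
by rewrite gtr_pMr// pi_gt0.
Qed.

Lemma turn_cosM s t :
  2 * (turn_cos s * turn_cos t) = turn_cos (s + t) + turn_cos (s - t).
Proof.
rewrite /turn_cos (mulrDr _ s t) (mulrBr _ s t) (cosD (2 * pi * s)).
by rewrite (cosB (2 * pi * s)); ring.
Qed.

End TurnFunctions.

(** * Fejer kernels *)

Section Fejer.
Context {R : realType}.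
Implicit Types (t : R) (p : nat).

(** The Fejer kernel of order p, normalised to have constant term 1. *)
Definition fejer p t : R :=
  1 + 2 * \sum_(1 <= j < p) (1 - j%:R / p%:R) * turn_cos (j%:R * t).

Lemma fejerE p t : (0 < p)%N ->
  p%:R * fejer p t =
  p%:R + 2 * \sum_(1 <= j < p) (p%:R - j%:R) * turn_cos (j%:R * t).
Proof.
move=> p0; have p0' : p%:R != 0 :> R by rewrite pnatr_eq0 -lt0n.
rewrite /fejer mulrDr mulr1 (mulrCA p%:R 2) (mulr_sumr _ _ _ p%:R).
congr (_ + 2 * _).
by apply: eq_bigr => j _; rewrite mulrA; congr (_ * _); field.
Qed.

(** The Dirichlet kernel in closed form: multiplying by 1 - cos makes the sum
    telescope. *)
Lemma dirichlet_closed p t :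
  (1 - turn_cos t) * (1 + 2 * \sum_(1 <= j < p.+1) turn_cos (j%:R * t)) =
  turn_cos (p%:R * t) - turn_cos (p.+1%:R * t).
Proof.
elim: p => [|p IH].
  rewrite big_geq// mulr0 addr0 mulr1 mul1r mul0r.
  by rewrite /turn_cos mulr0 cos0.
rewrite big_nat_recr//=; set S := \sum_(_ <= _ < _) _ in IH *.
have := turn_cosM (p.+1%:R * t) t.
have -> : p.+1%:R * t + t = p.+2%:R * t by rewrite -[in RHS]natr1; ring.
have -> : p.+1%:R * t - t = p%:R * t by rewrite -[in LHS]natr1; ring.
move=> h; rewrite (_ : _ * _ = (1 - turn_cos t) * (1 + 2 * S) +
  (2 * turn_cos (p.+1%:R * t) - 2 * (turn_cos (p.+1%:R * t) * turn_cos t))).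
  by rewrite IH h; ring.
by ring.
Qed.

(** Consecutive unnormalised Fejer kernels differ by a Dirichlet kernel, so the
    closed form follows by telescoping once more. *)
Lemma fejer_closed p t : (0 < p)%N ->
  (1 - turn_cos t) * (p%:R * fejer p t) = 1 - turn_cos (p%:R * t).
Proof.
move=> /fejerE ->.
elim: p => [|p IH].
  by rewrite big_geq// !(mul0r, mulr0, addr0) /turn_cos mulr0 cos0 subrr.
have -> : p.+1%:R + 2 * \sum_(1 <= j < p.+1) (p.+1%:R - j%:R) * turn_cos (j%:R * t)
  = (p%:R + 2 * \sum_(1 <= j < p) (p%:R - j%:R) * turn_cos (j%:R * t)) +
    (1 + 2 * \sum_(1 <= j < p.+1) turn_cos (j%:R * t)) :> R.
  have -> : \sum_(1 <= j < p) (p%:R - j%:R) * turn_cos (j%:R * t) =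
     \sum_(1 <= j < p.+1) (p%:R - j%:R) * turn_cos (j%:R * t).
    case: p {IH} => [|p]; first by rewrite !big_geq.
    by rewrite [RHS]big_nat_recr//= subrr mul0r addr0.
  have -> : \sum_(1 <= j < p.+1) (p.+1%:R - j%:R) * turn_cos (j%:R * t) =
     \sum_(1 <= j < p.+1) (p%:R - j%:R) * turn_cos (j%:R * t) +
     \sum_(1 <= j < p.+1) turn_cos (j%:R * t).
    by rewrite -big_split/=; apply: eq_bigr => j _; rewrite -natr1; ring.
  by rewrite -natr1; ring.
by rewrite mulrDr IH dirichlet_closed; ring.
Qed.

Lemma turn_cos_le1 t : turn_cos t <= 1.
Proof. exact: cos_le1. Qed.

Lemma turn_cos_eq1 t p : turn_cos t = 1 -> turn_cos (p%:R * t) = 1.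
Proof.
have E u : turn_cos u = 1 <-> turn_sin u = 0.
  rewrite turn_cosE; split=> [h|->]; last by rewrite expr0n mulr0 subr0.
  by apply/eqP; rewrite -[_ == 0](expf_eq0 _ 2); apply/eqP; lra.
move=> /E t0; apply/E; elim: p => [|p IH].
  by rewrite mul0r /turn_sin mulr0 sin0 normr0.
apply/eqP; rewrite eq_le normr_ge0 andbT -natr1 mulrDl mul1r.
by apply: (le_trans (turn_sinD _ _)); rewrite IH t0 addr0.
Qed.

(** The closed form gives the sign except where turn_cos t = 1; there all the
    cosines are 1. *)
Lemma fejer_ge0 p t : (0 < p)%N -> 0 <= fejer p t.
Proof.
move=> p0; have p0' : 0 < p%:R :> R by rewrite ltr0n.
have := turn_cos_le1 t; rewrite le_eqVlt => /orP[/eqP t1|t1].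
  rewrite /fejer addr_ge0// mulr_ge0// big_nat sumr_ge0// => j /andP[_ jp].
  rewrite turn_cos_eq1// mulr1 subr_ge0 ler_pdivrMr// mul1r ler_nat.
  exact: ltnW.
rewrite -(pmulr_rge0 _ p0') -(@pmulr_rge0 _ (1 - turn_cos t)) ?subr_gt0//.
by rewrite fejer_closed// subr_ge0 turn_cos_le1.
Qed.

Lemma fejer_le p t e : (0 < p)%N -> 0 < e -> turn_cos t <= 1 - e ->
  fejer p t <= 2 / (p%:R * e).
Proof.
move=> p0 e0 te; have p0' : 0 < p%:R :> R by rewrite ltr0n.
rewrite ler_pdivlMr ?mulr_gt0//.
have h : fejer p t * (p%:R * e) <= (1 - turn_cos t) * (p%:R * fejer p t).
  have -> : (1 - turn_cos t) * (p%:R * fejer p t) =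
            fejer p t * (p%:R * (1 - turn_cos t)) by ring.
  by rewrite ler_wpM2l ?fejer_ge0// ler_wpM2l// lerBrDr addrC -lerBrDr.
apply: (le_trans h); rewrite fejer_closed//.
have : -1 <= turn_cos (p%:R * t) by exact: cos_geN1.
by lra.
Qed.

End Fejer.

(** * Mean values of sequences *)

Section MeanValue.
Context {R : realType}.
Implicit Types (w f : R) (p q n : nat).

Definition has_mean (u : nat -> R) (l : R) : Prop :=
  arithmetic_mean u @ \oo --> l.

Lemma arithmetic_meanE (u : nat -> R) n :
  arithmetic_mean u n = n.+1%:R^-1 * \sum_(0 <= q < n.+1) u q.
Proof. by rewrite /arithmetic_mean seriesEnat. Qed.

Lemma has_mean_cst l : has_mean (fun=> l) l.
Proof.
apply: cvg_near_cst; apply: nearW => n; apply/eqP.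
by rewrite arithmetic_meanE sumr_const_nat subn0 -[l *+ _]mulr_natl mulKf.
Qed.

Lemma has_meanD (u v : nat -> R) l l' : has_mean u l -> has_mean v l' ->
  has_mean (fun q => u q + v q) (l + l').
Proof.
move=> ul vl; rewrite /has_mean (_ : arithmetic_mean _ =
  (fun n => arithmetic_mean u n + arithmetic_mean v n)); first exact: cvgD.
by apply/funext => n; rewrite !arithmetic_meanE big_split mulrDr.
Qed.

Lemma has_meanZ (u : nat -> R) c l : has_mean u l ->
  has_mean (fun q => c * u q) (c * l).
Proof.
move=> ul; rewrite /has_mean (_ : arithmetic_mean _ =
  (fun n => c * arithmetic_mean u n)); first exact: cvgMl_tmp.
by apply/funext => n; rewrite !arithmetic_meanE -mulr_sumr mulrCA.
Qed.

Lemma has_mean_sum (I : eqType) (s : seq I) (u : I -> nat -> R) (l : I -> R) :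
  (forall i, i \in s -> has_mean (u i) (l i)) ->
  has_mean (fun q => \sum_(i <- s) u i q) (\sum_(i <- s) l i).
Proof.
elim: s => [|i s IH] h.
  rewrite big_nil; under eq_fun do rewrite big_nil; exact: has_mean_cst.
rewrite big_cons; under eq_fun do rewrite big_cons.
apply: has_meanD; first by apply: h; rewrite mem_head.
by apply: IH => j js; apply: h; rewrite inE js orbT.
Qed.

Lemma has_meanD0 (u v : nat -> R) l : has_mean u l -> has_mean v 0 ->
  has_mean (fun q => u q + v q) l.
Proof. by move=> ul /(has_meanD _ _ _ _ ul); rewrite addr0. Qed.

Lemma has_meanZ0 (u : nat -> R) c : has_mean u 0 ->
  has_mean (fun q => c * u q) 0.
Proof. by move=> /(has_meanZ _ c); rewrite mulr0. Qed.

Lemma has_mean_sum0 (I : eqType) (s : seq I) (u : I -> nat -> R) :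
  (forall i, i \in s -> has_mean (u i) 0) ->
  has_mean (fun q => \sum_(i <- s) u i q) 0.
Proof. by move=> /has_mean_sum; rewrite big1_eq. Qed.

Lemma has_mean_le (u v : nat -> R) l l' : has_mean u l -> has_mean v l' ->
  (forall q, u q <= v q) -> l <= l'.
Proof.
move=> ul vl uv; apply: (ler_cvg_to ul vl); apply: nearW => n.
rewrite !arithmetic_meanE ler_wpM2l ?invr_ge0//.
by apply: ler_sum => q _; exact: uv.
Qed.

(** Multiplied by 2 sin (pi * w), the sum of the cosines telescopes, hence it
    stays bounded. *)
Lemma has_mean_turn_cos w f : ~ (exists z : int, w = z%:~R) ->
  has_mean (fun q => turn_cos (q%:R * w + f)) 0.
Proof.
move=> wZ; have s0 : sin (pi * w) != 0.
  by rewrite -normr_gt0; exact: turn_sin_gt0.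
set s := sin (pi * w) in s0 *.
pose g q := sin (2 * pi * (q%:R * w + f) - pi * w).
have gE n : \sum_(0 <= q < n.+1) turn_cos (q%:R * w + f) =
    (g n.+1 - g 0%N) / (2 * s).
  rewrite -(telescope_sumr g (leq0n _)) mulr_suml; apply: eq_bigr => q _.
  apply: (@mulIf _ (2 * s)); first by rewrite mulf_neq0.
  rewrite mulfVK ?mulf_neq0// /g.
  have -> : 2 * pi * (q.+1%:R * w + f) - pi * w =
            2 * pi * (q%:R * w + f) + pi * w by rewrite -natr1; ring.
  by rewrite sinD sinB /turn_cos -/s; ring.
apply/cvgr0Pnorm_lt => e e0.
have : n.+1%:R^-1 @[n --> \oo] --> (0 : R) by exact: cvg_harmonic.
move=> /cvgr0Pnorm_lt /(_ (e * `|s|)).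
have es0 : 0 < e * `|s| by rewrite mulr_gt0// normr_gt0.
move=> /(_ es0); apply: filterS => n hn.
rewrite arithmetic_meanE gE mulrA normrM normfV.
rewrite ltr_pdivrMr ?normr_gt0 ?mulf_neq0// normrM.
have h2 : `|g n.+1 - g 0%N| <= 2.
  apply: (le_trans (ler_normB _ _)).
  have := sin_max (2 * pi * (n.+1%:R * w + f) - pi * w).
  have := sin_max (2 * pi * (0%:R * w + f) - pi * w).
  by rewrite /g; lra.
apply: (@le_lt_trans _ _ (`|n.+1%:R^-1| * 2)); first by rewrite ler_wpM2l.
by rewrite normrM [ `|2| ]ger0_norm//; nra.
Qed.

End MeanValue.

(** * Kronecker's theorem *)

Section Kronecker.
Context {R : realType}.
Variable a : nat -> R.
Implicit Types (x y t w f : R) (p q n : nat) (s : seq nat).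

(** Membership in the additive group generated by 1 and the a k for k in s,
    by recursion on s so that it matches the expansion of a product of Fejer
    kernels one factor at a time. *)
Fixpoint zspan s w : Prop :=
  if s is k :: s' then exists c : int, zspan s' (w - c%:~R * a k)
  else exists z : int, w = z%:~R.

Lemma zspan_cons k s w (c : int) : zspan s (w + c%:~R * a k) -> zspan (k :: s) w.
Proof. by exists (- c); rewrite mulrNz mulNr opprK. Qed.

(** This says that 1 and all the a k are linearly independent over the
    rationals. *)
Definition independent_mod1 :=
  forall s k j, k \notin s -> (0 < j)%N -> ~ zspan s (j%:R * a k).

Variable theta : nat -> R.

Let F p k q := fejer p (q%:R * a k - theta k).

(** Expanding one factor of the product into cosines changes the frequency w by
    integer multiples of one a k, so all the frequencies that arise stay
    outside the integers. *)
Lemma has_mean_cos_prod p s w f : ~ zspan s w ->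
  has_mean (fun q => turn_cos (q%:R * w + f) * \prod_(k <- s) F p k q) 0.
Proof.
elim: s w f => [|k s IH] w f ws.
  under eq_fun do rewrite big_nil mulr1.
  exact: has_mean_turn_cos.
have E q : turn_cos (q%:R * w + f) * \prod_(i <- k :: s) F p i q =
  turn_cos (q%:R * w + f) * \prod_(i <- s) F p i q +
  \sum_(1 <= j < p) (1 - j%:R / p%:R) *
   (turn_cos (q%:R * (w + j%:R * a k) + (f - j%:R * theta k)) *
      \prod_(i <- s) F p i q +
    turn_cos (q%:R * (w - j%:R * a k) + (f + j%:R * theta k)) *
      \prod_(i <- s) F p i q).
  rewrite big_cons {1}/F /fejer; set P := \prod_(_ <- _) _.
  rewrite mulrA mulrDr mulr1 mulrDl; congr (_ + _).
  rewrite [X in X * P]mulrCA mulr_sumr mulr_sumr mulr_suml.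
  apply: eq_bigr => j _; rewrite -mulrDl.
  have -> : q%:R * (w + j%:R * a k) + (f - j%:R * theta k) =
    (q%:R * w + f) + j%:R * (q%:R * a k - theta k) by ring.
  have -> : q%:R * (w - j%:R * a k) + (f + j%:R * theta k) =
    (q%:R * w + f) - j%:R * (q%:R * a k - theta k) by ring.
  by rewrite -turn_cosM; ring.
under eq_fun do rewrite E.
apply: has_meanD0.
  by apply: IH => h; apply: ws; apply: (@zspan_cons _ _ _ 0); rewrite mul0r addr0.
apply: has_mean_sum0 => j _;
apply: has_meanZ0; apply: has_meanD0; apply: IH => h; apply: ws.
  by apply: (@zspan_cons _ _ _ j).
by apply: (@zspan_cons _ _ _ (- j%:Z)); rewrite mulrNz mulNr.
Qed.

Hypothesis a_indep : independent_mod1.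

(** Only the product of the constant terms contributes: all the other
    frequencies are nonzero modulo 1 by independence. *)
Lemma has_mean_prod_fejer p s : uniq s ->
  has_mean (fun q => \prod_(k <- s) F p k q) 1.
Proof.
elim: s => [|k s IH] /=.
  by move=> _; under eq_fun do rewrite big_nil; exact: has_mean_cst.
move=> /andP[ks us].
have E q : \prod_(i <- k :: s) F p i q = \prod_(i <- s) F p i q +
  \sum_(1 <= j < p) (2 * (1 - j%:R / p%:R)) *
   (turn_cos (q%:R * (j%:R * a k) + (- (j%:R * theta k))) *
      \prod_(i <- s) F p i q).
  rewrite big_cons {1}/F /fejer mulrDl mul1r; congr (_ + _).
  rewrite mulr_sumr mulr_suml; apply: eq_bigr => j _.
  have -> : q%:R * (j%:R * a k) + - (j%:R * theta k) =
    j%:R * (q%:R * a k - theta k) by ring.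
  by ring.
under eq_fun do rewrite E.
apply: has_meanD0; first exact: IH.
apply: has_mean_sum0 => j; rewrite mem_index_iota => /andP[j0 _].
by apply: has_meanZ0; apply: has_mean_cos_prod; exact: a_indep.
Qed.

(** If some factor were at most eta for every q, then the product would be at
    most eta times the sum of the products with one factor removed.  Taking
    mean values yields 1 <= n * eta, and eta = 2 / (p * e) is as small as one
    likes. *)
Lemma kronecker_cos n e : 0 < e ->
  exists q, forall k, (k < n)%N -> 1 - e < turn_cos (q%:R * a k - theta k).
Proof.
move=> e0; apply: contrapT => nq.
have bad q : exists2 k, (k < n)%N & turn_cos (q%:R * a k - theta k) <= 1 - e.
  apply: contrapT => h; apply: nq; exists q => k kn.
  by rewrite ltNge; apply/negP => ?; apply: h; exists k.
pose p := (Num.truncn (n%:R * 2 / e : R)).+1.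
have p0 : (0 < p)%N by [].
have p0' : 0 < p%:R :> R by rewrite ltr0n.
have pb : n%:R * (2 / (p%:R * e)) < 1 :> R.
  have : n%:R * 2 / e < p%:R :> R by exact: truncnS_gt.
  rewrite ltr_pdivrMr// => h.
  by rewrite mulrA ltr_pdivrMr ?mulr_gt0// mul1r.
set eta := 2 / (p%:R * e) in pb.
have eta0 : 0 <= eta by rewrite divr_ge0// mulr_ge0// ltW.
have F0 k q : 0 <= F p k q by exact: fejer_ge0.
pose G k q := \prod_(i <- [seq i <- iota 0 n | i != k]) F p i q.
have le q : \prod_(k <- iota 0 n) F p k q <= \sum_(k <- iota 0 n) eta * G k q.
  have [k kn ck] := bad q.
  have kI : k \in iota 0 n by rewrite mem_iota.
  rewrite (bigD1_seq k) ?iota_uniq//= [leRHS](bigD1_seq k) ?iota_uniq//=.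
  rewrite -[leLHS]addr0; apply: lerD.
    rewrite /G big_filter ler_wpM2r ?prodr_ge0//.
    exact: fejer_le.
  by apply: sumr_ge0 => j _; rewrite mulr_ge0// prodr_ge0.
have : 1 <= \sum_(k <- iota 0 n) eta * 1.
  apply: (has_mean_le _ _ _ _ _ _ le); first by apply: has_mean_prod_fejer; exact: iota_uniq.
  apply: has_mean_sum => k _; apply: has_meanZ; apply: has_mean_prod_fejer.
  by rewrite filter_uniq// iota_uniq.
rewrite mulr1 big_const_seq count_predT size_iota iter_addr_0 -[eta *+ _]mulr_natl.
by rewrite leNgt pb.
Qed.

End Kronecker.

(** Shifting the targets by a allows a multiplier q + 1, which is positive. *)
Lemma kronecker {R : realType} (a theta : nat -> R) n (r : R) :
  independent_mod1 a -> 0 < r ->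
  exists2 q, (0 < q)%N &
    forall k, (k < n)%N -> turn_sin (q%:R * a k - theta k) < r.
Proof.
move=> ai r0.
have e0 : 0 < 2 * r ^+ 2 by rewrite mulr_gt0// exprn_gt0.
have [q hq] := kronecker_cos a (fun k => theta k - a k) ai n _ e0.
exists q.+1 => // k /hq.
have -> : q%:R * a k - (theta k - a k) = q.+1%:R * a k - theta k.
  by rewrite -[in RHS]natr1; ring.
rewrite turn_cosE => h.
rewrite -(@ltr_pXn2r _ 2) ?nnegrE ?normr_ge0// ?ltW//; lra.
Qed.

(** * Independence of a tail together with 1 *)

Section Independence.
Context {R : realType}.
Implicit Types (n d : nat) (z : int).

Lemma zspanP (a : nat -> R) (s : seq nat) w n : zspan a s w ->
  (forall i, i \in s -> (i < n)%N) ->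
  exists (c : nat -> int) (z : int),
    w = z%:~R + \sum_(i < n) (c i)%:~R * a i /\
    forall i, i \notin s -> c i = 0.
Proof.
elim: s w => [|k s IH] w /=.
  move=> [z ->] _; exists (fun=> 0), z; split => //.
  by rewrite big1 ?addr0// => i _; rewrite mul0r.
move=> [c0 /IH ws] sn.
have [|c [z [wE c0E]]] := ws; first by move=> i si; apply: sn; rewrite inE si orbT.
have kn : (k < n)%N by apply: sn; rewrite mem_head.
exists (fun i => c i + (i == k)%:R * c0), z; split; last first.
  by move=> i; rewrite inE negb_or => /andP[/negPf -> /c0E ->]; rewrite mul0r addr0.
move/eqP: wE; rewrite subr_eq => /eqP ->; rewrite -addrA; congr (_ + _).
under [RHS]eq_bigr do rewrite intrD mulrDl.
rewrite big_split/=; congr (_ + _).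
rewrite (bigD1 (Ordinal kn))//= eqxx mul1r big1 ?addr0// => i.
by rewrite -val_eqE/= => /negPf ->; rewrite !mul0r.
Qed.

(** Independence together with 1, in terms of explicit coefficients. *)
Definition no_integer_relation (b : nat -> R) :=
  forall n (c : nat -> int) z, \sum_(i < n) (c i)%:~R * b i = z%:~R ->
  forall i, (i < n)%N -> c i = 0.

(** Two relations that involve disjoint sets of terms and have nonzero integer
    values could be combined into a relation with value 0.  So the terms that
    follow one such relation are independent together with 1. *)
Lemma independent_tail (alpha : nat -> R) : algebraically_independent alpha ->
  exists L, no_integer_relation (fun k => alpha (L + k)%N).
Proof.
move=> ind.
have [h|] := pselect (no_integer_relation alpha); first by exists 0%N.
move=> /existsNP[n /existsNP[c /existsNP[z /not_implyP[cz]]]].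
move=> /existsNP[i0 /not_implyP[i0n ci0]].
have z0 : z != 0.
  apply/eqP => z0; apply: ci0.
  by apply: (ind n (fun i => c i) _ (Ordinal i0n)); rewrite cz z0.
exists n => n' c' z' cz' i i_n'.
(* z' times the first relation minus z times the second one *)
pose b (k : 'I_(n + n')) : int :=
  match fintype.split k with inl j => z' * c j | inr j => - (z * c' j) end.
have /ind/(_ (rshift n (Ordinal i_n'))) :
    \sum_(k < n + n') (b k)%:~R * alpha k = 0 :> R.
  rewrite big_split_ord/=.
  have -> : \sum_(k < n) (b (lshift n' k))%:~R * alpha k = z'%:~R * z%:~R.
    rewrite -cz mulr_sumr; apply: eq_bigr => k _.
    by rewrite /b (unsplitK (inl k)) intrM mulrA.
  have -> : \sum_(k < n') (b (rshift n k))%:~R * alpha (n + k)%N =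
      - (z%:~R * z'%:~R).
    rewrite -cz' mulr_sumr -sumrN; apply: eq_bigr => k _.
    by rewrite /b (unsplitK (inr k)) mulrNz intrM mulNr mulrA.
  by rewrite mulrC subrr.
rewrite /b (unsplitK (inr _))/= => /eqP.
by rewrite oppr_eq0 mulf_eq0 (negPf z0)/= => /eqP.
Qed.

Lemma independent_mod1_scale (b : nat -> R) d : no_integer_relation b ->
  (0 < d)%N -> independent_mod1 (fun k => d%:R * b k).
Proof.
move=> nb d0 s k j ks j0 sp.
pose n := (k + \sum_(i <- s) i).+1.
have sn i : i \in s -> (i < n)%N.
  by move=> si; rewrite ltnS (leq_trans _ (leq_addl _ _))// (big_rem i)//= leq_addr.
have [c [z [E c0]]] := zspanP _ _ _ _ sp sn.
have kn : (k < n)%N by rewrite ltnS leq_addr.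
have := nb n (fun i => d%:Z * c i - (i == k)%:Z * (j * d)%:Z) (- z) _ k kn.
rewrite eqxx c0// mulr0 sub0r mul1r => h.
suff : (j * d)%N = 0%N by apply/eqP; rewrite -lt0n muln_gt0 j0.
apply/eqP; rewrite -eqz_nat -oppr_eq0; apply/eqP/h.
under eq_bigr do rewrite intrB mulrBl.
rewrite sumrB [X in _ - X](bigD1 (Ordinal kn))//= eqxx mul1r.
rewrite [X in _ - (_ + X)]big1 ?addr0; last first.
  by move=> i; rewrite -val_eqE/= => /negPf ->; rewrite mul0r.
rewrite mulrNz; move: E; rewrite PoszM intrM -mulrA => /= ->.
rewrite opprD addrCA [X in _ + (X - _)](_ : _ = \sum_(i < n) (c i)%:~R * (d%:R * b i)).
  by rewrite subrr addr0.
by apply: eq_bigr => i _; rewrite intrM mulrA [_%:~R * d%:R]mulrC.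
Qed.

End Independence.

(** * One block of the construction *)

Section Block.
Context {R : realType}.
Implicit Types (x y r B : R) (k n K M Q : nat).

Lemma continuous_turn_sin (Q : R) : continuous (fun y : R => turn_sin (Q * y)).
Proof.
move=> y; rewrite /turn_sin; apply: cvg_norm.
apply: (continuous_comp (f := fun y : R => pi * (Q * y))); last exact: continuous_sin.
by apply: cvgMl_tmp; apply: cvgMl_tmp; exact: cvg_id.
Qed.

Lemma turn_sin_net r : 0 < r ->
  exists2 M, (0 < M)%N &
    forall x, exists2 i, (i < M)%N & turn_sin (x + i%:R / M%:R) < r.
Proof.
move=> r0.
have /cvgrPdist_lt/(_ r r0) := @continuous_turn_sin 1 0.
move=> /nbhs_ballP[e /= e0 he].
have small (t : R) : 0 <= t -> t < e -> turn_sin t < r.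
  move=> t0 te; have /= := he t; rewrite /ball/= sub0r normrN ger0_norm//.
  move=> /(_ te); rewrite mulr0 mul1r /turn_sin mulr0 sin0 normr0 sub0r normrN.
  by rewrite normr_id.
pose M := (Num.truncn e^-1).+1; exists M => // x.
have M0 : 0 < M%:R :> R by rewrite ltr0n.
have Me : M%:R^-1 < e by rewrite invf_plt ?posrE//; exact: truncnS_gt.
(* the i with i / M just below the fractional part of - x *)
pose v := - x - (Num.floor (- x))%:~R.
have v0 : 0 <= v by rewrite subr_ge0 floor_le.
have v1 : v < 1 by rewrite ltrBlDl -[1]/(1%:~R) -intrD floorD1_gt.
have vM0 : 0 <= v * M%:R by rewrite mulr_ge0// ltW.
exists (Num.truncn (v * M%:R)).
  by rewrite -(ltr_nat R) (@le_lt_trans _ _ (v * M%:R)) ?truncn_le// gtr_pMl.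
set i := Num.truncn _.
have iv : i%:R <= v * M%:R by rewrite truncn_le.
have vi : v * M%:R < i%:R + 1 by rewrite natr1; exact: truncnS_gt.
rewrite -turn_sinN -(turn_sinDz _ (- Num.floor (- x))) mulrNz.
have -> : - (x + i%:R / M%:R) - (Num.floor (- x))%:~R = v - i%:R / M%:R.
  by rewrite /v; ring.
apply: small; first by rewrite subr_ge0 ler_pdivrMr.
apply: lt_trans Me; rewrite ltrBlDr -{1}[M%:R^-1]mul1r -mulrDl ltr_pdivlMr//.
by rewrite addrC.
Qed.

Variable alpha : nat -> R.
Hypothesis alpha_incr : increasing_seq alpha.
Hypothesis alpha_cvg : alpha k @[k --> \oo] --> +oo.

Lemma sparse_subsequence B K :
  exists sigma : nat -> nat, [/\ forall i, (K <= sigma i)%N,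
    forall i, B <= alpha (sigma i) &
    forall i j, (i < j)%N -> alpha (sigma i) + 1 <= alpha (sigma j)].
Proof.
have far A : exists k, (K <= k)%N /\ A <= alpha k.
  move/cvgryPge : alpha_cvg => /(_ A)[k _ hk].
  by exists (maxn K k); split; [exact: leq_maxl|apply: hk; rewrite /= leq_maxr].
have [h hK] := choice far.
pose sigma i := iter i (fun k => h (alpha k + 1)) (h B).
have step i : alpha (sigma i) + 1 <= alpha (sigma i.+1) by have [] := hK (alpha (sigma i) + 1).
have gap i j : (i < j)%N -> alpha (sigma i) + 1 <= alpha (sigma j).
  elim: j => // j IH; rewrite ltnS leq_eqVlt => /orP[/eqP ->//|/IH ij].
  by have := step j; lra.
exists sigma; split => // i.
  by case: i => [|i]; [have [] := hK B|have [] := hK (alpha (sigma i) + 1)].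
have hB : B <= alpha (sigma 0%N) by have [] := hK B.
by case: i => [//|i]; have := gap 0%N i.+1 isT; lra.
Qed.

Variable Lam1 : set R.
Hypothesis Lam1_dyadic : forall B, exists m, forall l, Lam1 l -> l <= B ->
  exists z : int, (2 ^ m)%:R * l = z%:~R.

(** The exceptional points of the last clause, where turn_sin (Q * x) < 3 * r,
    are the only ones of [1/2, 3/4] that a translation can send into U.  For
    l in Lam1 this is because Q * l is an integer, for l = alpha (sigma i)
    because the gaps of sigma keep x + l out of the intervals, and for the
    other l = alpha k because Q * l is r-close to an integer. *)
Lemma divergence_block r K : algebraically_independent alpha -> 0 < r ->
  exists Q (U : set (measurableTypeR R)), [/\ (0 < Q)%N, measurable U,
    (forall x, 0 <= x <= 1 / 4 -> exists2 k, (K <= k)%N & U (x + alpha k)) &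
    (forall x, 1 / 2 <= x <= 3 / 4 -> 3 * r <= turn_sin (Q%:R * x) ->
       forall l, (Lam1 `|` range alpha) l -> ~ U (x + l))].
Proof.
move=> /independent_tail[L aL] r0.
have [M M0 net] := turn_sin_net r r0.
have [sigma [sK sL gap]] := sparse_subsequence (alpha L + 1) K.
have [m hm] := Lam1_dyadic (alpha (sigma M)).
pose S := mkseq sigma M.
have s_inj : injective sigma.
  move=> i j ij; by case: (ltngtP i j) => // /gap; rewrite ij => h; exfalso; lra.
have S_uniq : uniq S by exact: mkseq_uniq.
have m0 : (0 < 2 ^ m)%N by rewrite expn_gt0.
(* An index outside S gets the value size S = M, that is, the phase 1, which
   is trivial modulo 1. *)
pose theta k : R := (index (L + k)%N S)%:R / M%:R.
have [q q0 hq] := kronecker _ theta (sigma M) r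
  (independent_mod1_scale _ _ aL m0) r0.
have {}hq k : (L <= k)%N -> (k < sigma M)%N ->
    turn_sin ((q * 2 ^ m)%:R * alpha k - (index k S)%:R / M%:R) < r.
  move=> Lk kM; have := hq (k - L)%N.
  rewrite /theta subnKC// natrM mulrA; apply.
  by rewrite (leq_ltn_trans (leq_subr _ _)).
pose Q := (q * 2 ^ m)%N; rewrite -/Q in hq.
have alt i j : (alpha i < alpha j) = (i < j)%N by rewrite (leW_mono alpha_incr).
have L_s i : (L <= sigma i)%N by rewrite -(alpha_incr L); have := sL i; lra.
pose U : set (measurableTypeR R) := (\bigcup_(i in `I_M) `[alpha (sigma i), alpha (sigma i) + 1 / 4]%classic)
  `&` [set y | turn_sin (Q%:R * y) < 2 * r].
exists Q, U; split.
- by rewrite muln_gt0 q0.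
- apply: measurableI; first by apply: bigcup_measurable => i _; exact: measurable_itv.
  rewrite (_ : [set y | _] = (fun y : R => turn_sin (Q%:R * y)) @^-1` `]-oo, 2 * r[%classic).
    have /(_ measurableT _ (measurable_itv `]-oo, 2 * r[)) :=
      continuous_measurable_fun (continuous_turn_sin Q%:R).
    by rewrite setTI.
  by apply/seteqP; split => y /=; rewrite in_itv.
- move=> x /andP[x0 x1]; have [i iM hi] := net (Q%:R * x).
  exists (sigma i); [exact: sK|split].
    by exists i => //=; rewrite in_itv/=; lra.
  have siM : (sigma i < sigma M)%N by rewrite -alt; have := gap _ _ iM; lra.
  have := hq _ (L_s i) siM.
  have -> : index (sigma i) S = i.
    by rewrite -(nth_mkseq 0%N sigma iM) index_uniq// size_mkseq.
  have := turn_sinD (Q%:R * x + i%:R / M%:R) (Q%:R * alpha (sigma i) - i%:R / M%:R).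
  have -> : Q%:R * x + i%:R / M%:R + (Q%:R * alpha (sigma i) - i%:R / M%:R) =
    Q%:R * (x + alpha (sigma i)) by ring.
  by rewrite /=; lra.
move=> x /andP[x0 x1] hx l Ll [[i /= iM]]; rewrite in_itv/= => /andP[il li] Ul.
have iM1 := gap _ _ iM.
have hbad (u : R) : turn_sin u < r -> turn_sin (Q%:R * (x + l) - u) < 3 * r.
  move=> ur; apply: (le_lt_trans (turn_sinD _ _)); rewrite turn_sinN.
  by rewrite /= in Ul; lra.
case: Ll => [Ll|[k _ lE]].
  have [z lz] : exists z : int, (2 ^ m)%:R * l = z%:~R by apply: hm => //; lra.
  have QE : Q%:R * (x + l) = Q%:R * x + (q%:Z * z)%:~R.
    by rewrite mulrDr intrM -lz /Q natrM mulrA.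
  by move: Ul => /=; rewrite QE turn_sinDz; lra.
have Lk : (L <= k)%N by apply: ltnW; rewrite -alt lE; have := sL i; lra.
have kM : (k < sigma M)%N by rewrite -alt lE; lra.
have [/(nthP 0%N)[j]|kS] := boolP (k \in S).
  rewrite size_mkseq => jM; rewrite nth_mkseq// => jk.
  case: (ltngtP i j) => [/gap|/gap|ij]; rewrite ?jk ?lE; [lra|lra|].
  by move: il li; rewrite ij jk lE; lra.
have := hq k Lk kM; rewrite (memNindex kS) size_mkseq divff ?pnatr_eq0 -?lt0n//.
have -> : Q%:R * alpha k - 1 = Q%:R * alpha k + (- 1)%:~R by rewrite intrN.
rewrite turn_sinDz lE => /hbad.
have -> : Q%:R * (x + l) - Q%:R * l = Q%:R * x by ring.
by lra.
Qed.

End Block.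

(** * Measure estimates and failure of the zero-one law *)

Section Measure.
Context {R : realType}.
Implicit Types (A B : set R) (w x t u v : R).

Local Notation leb := (@completed_lebesgue_measure R).

(** As a function of arbitrary sets, leb is the Lebesgue outer measure, so
    monotonicity and subadditivity hold without measurability. *)
Lemma leb_le A B : A `<=` B -> (leb A <= leb B)%E.
Proof. exact: (@le_outer_measure _ _ (wlength (@idfun R))^*%mu). Qed.

Lemma leb_setU A B : (leb (A `|` B) <= leb A + leb B)%E.
Proof. exact: (outer_measureU2 (wlength (@idfun R))^*%mu). Qed.

Lemma leb_bigsetU (F : (set R)^nat) n :
  (leb (\big[setU/set0]_(i < n) F i) <= \sum_(i < n) leb (F i))%E.
Proof. exact: (outer_measure_subadditive (wlength (@idfun R))^*%mu). Qed.

Lemma leb_bigcup (F : (set R)^nat) :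
  (leb (\bigcup_i F i) <= \sum_(i <oo) leb (F i))%E.
Proof. exact: (outer_measure_sigma_subadditive (wlength (@idfun R))^*%mu). Qed.

Lemma leb_itv (i : interval R) : leb [set` i] =
  (if i.1 < i.2 then (i.2 : \bar R) - i.1 else 0)%E.
Proof. exact: lebesgue_measure_itv. Qed.

Lemma turn_sin_sub w t : 0 < w <= 1 / 2 -> 0 <= t -> t < 1 ->
  turn_sin t < turn_sin w -> t < w \/ 1 - w < t.
Proof.
move=> /andP[w0 w2] t0 t1.
have pi0 : 0 < pi :> R by exact: pi_gt0.
have inc (u v : R) : 0 <= u -> u <= v -> v <= 1 / 2 -> turn_sin u <= turn_sin v.
  move=> u0 uv v2.
  have pu : 0 <= pi * u by apply: mulr_ge0 => //; exact: pi_ge0.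
  have puv : pi * u <= pi * v by rewrite ler_pM2l.
  have pv : pi * v <= pi / 2 by rewrite ler_pM2l//; lra.
  have ppi : pi / 2 <= pi :> R by lra.
  rewrite /turn_sin !ger0_norm ?sin_ge0_pi//; try by apply/andP; split; lra.
  rewrite le_eqVlt in puv; case/orP: puv => [/eqP ->//|puv].
  by rewrite ltW// ltr_sin// in_itv/=; apply/andP; split; lra.
have sym : turn_sin (1 - t) = turn_sin t.
  by rewrite addrC -[1]/(1%:R) turn_sinDn turn_sinN.
case: (ltP t w) => [|wt h]; first by left.
right; rewrite ltNge; apply/negP => tw.
suff : turn_sin w <= turn_sin t by rewrite leNgt h.
by case: (leP t (1 / 2)) => t2; [apply: inc => //; lra|rewrite -sym; apply: inc => //; lra].
Qed.

(** Q * x is w-close to one of the integers 0, ..., Q; the corresponding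
    Q + 1 <= 2 * Q intervals have length 2 * w / Q each. *)
Lemma small_turn_sin_cover w Q : 0 < w <= 1 / 2 -> (0 < Q)%N ->
  exists V : set R, (leb V <= (4 * w)%:E)%E /\
   forall x, 0 <= x < 1 -> turn_sin (Q%:R * x) < turn_sin w -> V x.
Proof.
move=> w01 Q0; have w0 : 0 < w by lra.
have Q0' : 0 < Q%:R :> R by rewrite ltr0n.
pose I (i : nat) : set R := `](i%:R - w) / Q%:R, (i%:R + w) / Q%:R[%classic.
exists (\big[setU/set0]_(i < Q.+1) I i); split.
  apply: (le_trans (leb_bigsetU _ _)).
  have IE i : leb (I i) = (2 * w / Q%:R)%:E.
    rewrite leb_itv /= lte_fin ltr_pM2r ?invr_gt0// ifT; last by lra.
    by rewrite -EFinB; congr (_%:E); field; rewrite gt_eqF.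
  under eq_bigr do rewrite IE.
  rewrite sumEFin lee_fin sumr_const card_ord -[leLHS]mulr_natl mulrA ler_pdivrMr//.
  have Q1 : 1 <= Q%:R :> R by rewrite ler1n.
  rewrite -natr1; nra.
move=> x /andP[x0 x1] hx.
have Qx0 : 0 <= Q%:R * x by rewrite mulr_ge0// ltW.
set z := Num.truncn (Q%:R * x).
have zl : z%:R <= Q%:R * x by rewrite truncn_le.
have zr : Q%:R * x < z%:R + 1 by rewrite natr1; exact: truncnS_gt.
have zQ : (z < Q)%N by rewrite -(ltr_nat R) (le_lt_trans zl)// gtr_pMr.
have : turn_sin (Q%:R * x - z%:R) < turn_sin w.
  by rewrite -[X in turn_sin X < _](subrK z%:R) subrK in hx *; rewrite -(turn_sinDn _ z) subrK.
rewrite -bigcup_mkord => /(turn_sin_sub _ _ w01)[| |h|h]; [lra|lra| |].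
  exists z => /=; first by rewrite ltnS ltnW.
  by rewrite /I /= in_itv/= ltr_pdivrMr// ltr_pdivlMr// [x * _]mulrC; apply/andP; split; lra.
exists z.+1 => //=.
by rewrite /I /= in_itv/= ltr_pdivrMr// ltr_pdivlMr// [x * _]mulrC -natr1; apply/andP; split; lra.
Qed.

Lemma lebesgue_measurable_indic (U : set (measurableTypeR R)) :
  measurable U -> lebesgue_measurable_fun (\1_U : R -> R).
Proof.
move=> mU _ Y mY; rewrite setTI.
by apply: sub_caratheodory; rewrite -[X in measurable X]setTI; exact: measurable_indic.
Qed.

Lemma translate_sum_indic0 (U Lambda : set R) x :
  (forall l, Lambda l -> ~ U (x + l)) -> translate_sum \1_U Lambda x = 0%E.
Proof.
by move=> h; apply: esum1 => l /h Ul; rewrite indicE memNset.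
Qed.

Lemma translate_sum_indicy (U Lambda : set R) x :
  infinite_set (Lambda `&` [set l | U (x + l)]) ->
  translate_sum \1_U Lambda x = +oo%E.
Proof.
move=> inf; apply/eqyP => /= A A0.
have [B BL hB] := infinite_set_fset (Num.truncn A).+1 inf.
apply: esum_ge; exists [set` B].
  by split; [exact: finite_fset|move=> l /BL[]].
rewrite fsbig_finite//= set_fsetK (eq_big_seq (fun=> 1%E)); last first.
  by move=> l lB; have [_ /= Ul] := BL l lB; rewrite indicE mem_set.
rewrite sumEFin lee_fin big_const_seq count_predT iter_addr_0.
apply: (@le_trans _ _ (Num.truncn A).+1%:R); first by rewrite ltW// truncnS_gt.
by rewrite ler_nat.
Qed.

Lemma finite_set_ubound A : finite_set A -> exists M, forall x, A x -> x <= M.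
Proof.
move=> /finite_seqP[s ->]; exists (\sum_(x <- s) `|x|) => x /= xs.
rewrite (big_rem x)//= (le_trans (ler_norm x))// lerDl.
by rewrite sumr_ge0.
Qed.

(** The hypothesis supplies blocks U whose exceptional sets
    turn_sin (Q * x) < 3 * r can be made as small as desired through r; the
    bound K%:R <= l forces infinitely many different l when K varies. *)
Lemma zero_one_law_fails (Lambda : set R) :
  (forall (r : R) K, 0 < r -> exists Q (U : set (measurableTypeR R)),
    [/\ (0 < Q)%N, measurable U,
    (forall x, 0 <= x <= 1 / 4 ->
       exists2 l, Lambda l /\ K%:R <= l & U (x + l)) &
    (forall x, 1 / 2 <= x <= 3 / 4 -> 3 * r <= turn_sin (Q%:R * x) ->
       forall l, Lambda l -> ~ U (x + l))]) ->
  ~ zero_one_law Lambda.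
Proof.
move=> block zol.
(* The exceptional sets then have measure at most 4 * w K, with sum 1 / 8,
   less than the length 1 / 4 of [1/2, 3/4]. *)
pose w (K : nat) : R := 1 / 8 / (2 ^ K.+1)%:R / 4.
have w01 K : 0 < w K <= 1 / 2.
  have p1 : 1 <= (2 ^ K.+1)%:R :> R by rewrite ler1n expn_gt0.
  have : (2 ^ K.+1)%:R^-1 <= 1 :> R by rewrite invf_le1// (lt_le_trans _ p1).
  have : 0 < (2 ^ K.+1)%:R^-1 :> R by rewrite invr_gt0 (lt_le_trans _ p1).
  by rewrite /w; lra.
have sw K : 0 < turn_sin (w K) / 3.
  rewrite divr_gt0// turn_sin_gt0// => -[z wz].
  have := w01 K; rewrite wz => /andP[z0 z1].
  have : (0 < z)%R by rewrite -(ltr0z R).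
  have : (z < 1)%R by rewrite -(ltrz1 R); lra.
  by lia.
have /choice[QUV hQUV] : forall K, exists QUV : nat * set (measurableTypeR R) * set R,
  [/\ measurable QUV.1.2,
    forall x, 0 <= x <= 1 / 4 ->
       exists2 l, Lambda l /\ K%:R <= l & QUV.1.2 (x + l),
    forall x, 1 / 2 <= x <= 3 / 4 -> ~ QUV.2 x ->
       forall l, Lambda l -> ~ QUV.1.2 (x + l) &
    (leb QUV.2 <= (1 / 8 / (2 ^ K.+1)%:R)%:E)%E].
  move=> K; have [Q [U [Q0 mU hD hC]]] := block _ K (sw K).
  have [V [mV hV]] := small_turn_sin_cover _ _ (w01 K) Q0.
  exists (Q, U, V); split => //=.
    move=> x x13 Vx; apply: hC => //; rewrite mulrC divfK// leNgt.
    by apply/negP => /hV Vx'; apply/Vx/Vx'; lra.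
  by move: mV; rewrite /w mulrC divfK.
pose U := \bigcup_K (QUV K).1.2; pose V := \bigcup_K (QUV K).2.
have mU : measurable U by apply: bigcup_measurable => K _; have [] := hQUV K.
have mV : (leb V <= (1 / 8)%:E)%E.
  apply: (le_trans (leb_bigcup _)).
  apply: le_trans (epsilon_trick0 xpredT (_ : 0 <= 1 / 8)); last by lra.
  by apply: lee_nneseries => // K _; have [] := hQUV K.
have [|D0|C0] := zol _ (lebesgue_measurable_indic _ mU).
- by move=> x; rewrite indicE.
- pose I : set R := `[0, 1 / 4]%classic.
  have : (leb I <= leb (D_set \1_U Lambda))%E.
    apply: leb_le => x; rewrite /I /= in_itv/= => x01.
    apply: translate_sum_indicy => fin.
    have [M hM] := finite_set_ubound _ fin.
    have [_ /(_ _ x01)[l [Ll Kl] Ul] _ _] := hQUV (Num.truncn M).+1.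
    have : l <= M by apply: hM; split => //; exists (Num.truncn M).+1.
    by rewrite leNgt (lt_le_trans _ Kl)// truncnS_gt.
  rewrite D0 /I leb_itv/= lte_fin ifT; last by lra.
  by rewrite -EFinB lee_fin; lra.
pose I : set R := `[1 / 2, 3 / 4]%classic.
have : (leb I <= leb (C_set \1_U Lambda `|` V))%E.
  apply: leb_le => x; rewrite /I /= in_itv/= => x01.
  have [Vx|Vx] := pselect (V x); [by right|left].
  rewrite /C_set/= translate_sum_indic0 ?ltry// => l Ll [K _ KU].
  have [_ _ /(_ x x01) h _] := hQUV K; apply: (h _ l Ll KU) => Vx'.
  by apply: Vx; exists K.
move=> /le_trans/(_ (leb_setU _ _)); rewrite C0 add0e => /le_trans/(_ mV).
rewrite /I leb_itv/= lte_fin ifT; last by lra.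
by rewrite -EFinB lee_fin; lra.
Qed.

End Measure.

(** * The set Lambda1 together with the sequence *)

Section TheSet.
Context {R : realType}.
Variables (N : option nat) (m n : nat -> nat).
Hypothesis n_incr : forall i j, below_length N j -> (i < j)%N -> (n i < n j)%N.

Lemma leq_block_start k : below_length N k -> (k <= n k)%N.
Proof.
elim: k => [//|k IH] Nk; apply: leq_ltn_trans (n_incr k k.+1 Nk (ltnSn k)).
by apply: IH; move: Nk; rewrite /below_length; case: N => // N' /ltnW.
Qed.

(** Only the blocks that start below B matter, and there are finitely many of
    them since n k >= k; the sum of their exponents serves for all of them. *)
Lemma Lambda1_dyadic (B : R) : exists p, forall l : R, Lambda1 N m n l -> l <= B ->
  exists z : int, (2 ^ p)%:R * l = z%:~R.
Proof.
pose s := [seq k <- iota 0 (Num.truncn B).+1 | below_length N k].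
exists (\sum_(k <- s) m k)%N.
move=> _ [k /= Nk [[j /= j0 <-]]] kn lB.
set l := _ * _ in kn lB.
have nl : (n k)%:R <= l.
  by move: kn; rewrite /block; case: ifP => _ /=; rewrite in_itv/= => /andP[].
have kB : (k < (Num.truncn B).+1)%N.
  rewrite -(ltr_nat R); apply: le_lt_trans (truncnS_gt B).
  by rewrite (le_trans _ (le_trans nl lB))// ler_nat leq_block_start.
have ks : k \in s by rewrite mem_filter Nk mem_iota.
rewrite (big_rem k ks) expnD /=.
move: (2 ^ \sum_(_ <- _) _)%N => t.
exists (t * j)%:Z; rewrite -[RHS]/((t * j)%:R) /l !natrM natrX.
by rewrite [_ * t%:R]mulrC -mulrA mulVKf// expf_neq0.
Qed.

Lemma Lambda1_gt0 (l : R) : Lambda1 N m n l -> 0 < l.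
Proof.
by move=> [k _ [[j /= j0 <-] _]]; rewrite mulr_gt0 ?invr_gt0 ?exprn_gt0// ltr0n.
Qed.

Lemma finite_Lambda1_le (B : R) : finite_set (Lambda1 N m n `&` [set l | l <= B]).
Proof.
have [p hp] := Lambda1_dyadic B.
have p0 : 0 < (2 ^ p)%:R :> R by rewrite ltr0n expn_gt0.
apply: (@sub_finite_set _ _
  ((fun a : nat => a%:R / (2 ^ p)%:R) @` `I_(Num.truncn ((2 ^ p)%:R * B)).+1)); last first.
  exact/finite_image/finite_II.
move=> l [L1l /= lB]; have [z hz] := hp l L1l lB.
have l0 := Lambda1_gt0 _ L1l.
have : 0 < z%:~R :> R by rewrite -hz mulr_gt0.
rewrite ltr0z; case: z hz => // a ha _.
exists a => /=; last by rewrite -[a%:R]/(a%:~R) -ha mulrC mulKf ?gt_eqF.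
rewrite -(ltr_nat R); apply: le_lt_trans (truncnS_gt _).
by rewrite -[a%:R]/(a%:~R) -ha ler_pM2l.
Qed.

Variable alpha : nat -> R.
Hypothesis alpha_incr : increasing_seq alpha.
Hypothesis alpha_cvg : alpha k @[k --> \oo] --> +oo.

Let Lambda := Lambda1 N m n `|` range alpha.

Lemma Lambda_unbounded (B : R) : exists2 l, Lambda l & B < l.
Proof.
move/cvgryPgt : alpha_cvg => /(_ B)[k _ hk].
by exists (alpha k); [right; exists k|apply: hk => /=].
Qed.

Lemma finite_Lambda_le (B : R) : finite_set (Lambda `&` [set l | l <= B]).
Proof.
rewrite setIUl finite_setU; split; first exact: finite_Lambda1_le.
move/cvgryPgt : alpha_cvg => /(_ B)[K _ hK].
apply: (@sub_finite_set _ _ (alpha @` `I_K)); last exact/finite_image/finite_II.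
move=> _ [[k _ <-] /= kB]; exists k => //=.
by rewrite ltnNge; apply/negP => /hK; rewrite ltNge kB.
Qed.

(** Since only finitely many elements lie below any given bound, there are no
    limit points. *)
Lemma Lambda_admissible : admissible Lambda.
Proof.
split.
- rewrite /Lambda -bigcup2E; apply: bigcup_countable => // -[|[|i]] _ /=; last first.
  + exact: countable0.
  + exact/(sub_countable (card_image_le _ _))/countableP.
  apply: bigcup_countable => // k _.
  apply: (sub_countable (subset_card_le (@subIsetl _ _ _))).
  exact/(sub_countable (card_image_le _ _))/countableP.
- move=> /finite_set_ubound[M hM]; have [l /hM lM] := Lambda_unbounded M.
  by rewrite ltNge lM.
- rewrite /bounded_set/= => -[M [_ hM]].
  have [l Ll Ml] := Lambda_unbounded (M + 1).
  have := hM (M + 1) _ l Ll; rewrite ltrDl ltr01 => /(_ isT) /=.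
  by rewrite leNgt (lt_le_trans Ml)// ler_norm.
- exists (Num.min 0 (alpha 0%N)) => l [/Lambda1_gt0 l0|[k _ <-]].
    by rewrite ge_min ltW.
  by rewrite ge_min (alpha_incr 0%N k) leq0n orbT.
apply/seteqP; split=> // x /limit_point_infinite_setP /(_ (ball x 1)).
move=> /(_ (nbhsx_ballx _ _ ltr01)); apply.
apply: sub_finite_set (finite_Lambda_le (x + 1)).
by move=> l [xl Ll]; split => //=; move: xl; rewrite /ball/= ltr_distlC; lra.
Qed.

End TheSet.

Theorem theorem3p1 (R : realType) (N : option nat) (m n : nat -> nat)
    (alpha : nat -> R)
    (N_gt0 : N <> Some 0%N)
    (m_gt0 : forall k, below_length N k -> (0 < m k)%N)
    (n_gt0 : forall k, below_length N k -> (0 < n k)%N)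
    (m_incr : forall i j, below_length N j -> (i < j)%N -> (m i < m j)%N)
    (n_incr : forall i j, below_length N j -> (i < j)%N -> (n i < n j)%N)
    (alpha_indep : algebraically_independent alpha)
    (alpha_irr : forall k, irrational (alpha k))
    (alpha_incr : increasing_seq alpha)
    (alpha_cvg : alpha k @[k --> \oo] --> +oo) :
  type2 (Lambda1 N m n `|` range alpha).
Proof.
split; first exact: Lambda_admissible.
move=> [_]; apply: zero_one_law_fails => r K r0.
move/cvgryPge : (alpha_cvg) => /(_ K%:R)[K' _ hK'].
have [Q [U [Q0 mU hD hC]]] := divergence_block alpha alpha_incr alpha_cvg _
  (Lambda1_dyadic N m n n_incr) r K' alpha_indep r0.
exists Q, U; split => // x /hD[k kK' Uk].
by exists (alpha k) => //; split; [right; exists k|exact: hK'].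
Qed.
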